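(* Let $(\mathcal{C},\mathcal{D})$ be a $C^*$-inclusion with the faithful unique pseudo-expectation property (more generally, such that every pseudo-expectation for $(\mathcal{C},\mathcal{D})$ is faithful). If $\mathcal{X}$ is an operator space with $\mathcal{D}\subseteq\mathcal{X}\subseteq\mathcal{C}$, then $C_e^*(\mathcal{X}) = C^*(\mathcal{X})$; that is, the $C^*$-envelope of $\mathcal{X}$ equals the $C^*$-subalgebra of $\mathcal{C}$ generated by $\mathcal{X}$.
   Context: All $C^*$-algebras are unital. A $C^*$-inclusion $(\mathcal{C},\mathcal{D})$ is a pair of unital $C^*$-algebras with $\mathcal{D} \subseteq \mathcal{C}$ and having the same unit. ''ucp'' means unital completely positive. A $C^*$-algebra is injective if it is an injective object in the category of operator systems and ucp maps. $I(\mathcal{D})$ denotes a fixed injective envelope of $\mathcal{D}$: an injective unital $C^*$-algebra containing $\mathcal{D}$ as a unital $C^*$-subalgebra, such that for every injective operator system $\mathcal{S}$ and unital complete isometry $\tau:\mathcal{D}\to\mathcal{S}$ there is a unital complete isometry $\tau_1:I(\mathcal{D})\to\mathcal{S}$ with $\tau_1|_{\mathcal{D}}=\tau$. A pseudo-expectation for $(\mathcal{C},\mathcal{D})$ is a ucp map $\Phi:\mathcal{C}\to I(\mathcal{D})$ with $\Phi|_{\mathcal{D}}=\operatorname{id}$; it is faithful if $\Phi(x^*x)=0$ implies $x=0$. The inclusion has the faithful unique pseudo-expectation property if exactly one pseudo-expectation exists and it is faithful. For a unital operator space $\mathcal{X}\subseteq\mathcal{C}$, let $C^*(\mathcal{X})$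 be the $C^*$-subalgebra of $\mathcal{C}$ generated by $\mathcal{X}$. There is a unique maximal closed two-sided ideal $\mathcal{J}$ of $C^*(\mathcal{X})$ such that the quotient map $q:C^*(\mathcal{X})\to C^*(\mathcal{X})/\mathcal{J}$ is completely isometric on $\mathcal{X}$; the $C^*$-envelope is $C_e^*(\mathcal{X})=C^*(\mathcal{X})/\mathcal{J}$. The equality $C_e^*(\mathcal{X})=C^*(\mathcal{X})$ means $\mathcal{J}=0$. *)

(* Defs.v *)
From HB Require Import structures.
From mathcomp Require Import all_boot all_order all_algebra.
From mathcomp Require Import complex.
From mathcomp Require Import all_classical all_reals all_analysis.
Import Order.TTheory GRing.Theory Num.Theory.

Set Implicit Arguments.
Unset Strict Implicit.
Unset Printing Implicit Defensive.

Local Open Scope classical_set_scope.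
Local Open Scope ring_scope.

(* MathComp-Analysis has no join of [normedModType] with ring structures (its
   only such join is the ring of scalars itself), so the real-valued C*-norm is
   part of the structure below, and completeness and closedness are spelled out
   in terms of it. *)

Definition norm_complete (R : realType) (V : zmodType) (N : V -> R) : Prop :=
  forall u : nat -> V,
    (forall e : R, 0 < e -> exists K, forall p q,
       (K <= p)%N -> (K <= q)%N -> N (u p - u q) < e) ->
    exists l, forall e : R, 0 < e -> exists K, forall p,
       (K <= p)%N -> N (u p - l) < e.

Record is_cstar_norm (R : realType) (T : pzRingType) (scale : R[i] -> T -> T)
    (star : T -> T) (N : T -> R) : Prop := {
  cstar_norm_ge0 : forall x, 0 <= N x;
  cstar_norm_eq0 : forall x, N x = 0 -> x = 0;
  cstar_normD : forall x y, N (x + y) <= N x + N y;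
  cstar_normZ : forall c x, N (scale c x) = ComplexField.Normc.normc c * N x;
  cstar_normM : forall x y, N (x * y) <= N x * N y;
  cstar_identity : forall x, N (star x * x) = N x ^+ 2;
  cstar_complete : norm_complete N
}.

HB.mixin Record isCstar (R : realType) A & GRing.Algebra R[i] A := {
  star : A -> A;
  starK : involutive star;
  starD : forall x y : A, star (x + y) = star x + star y;
  starZ : forall (c : R[i]) (x : A), star (c *: x) = Num.conj c *: star x;
  starM : forall x y : A, star (x * y) = star y * star x;
  cnorm : A -> R;
  cnormP : is_cstar_norm (fun (c : R[i]) (x : A) => c *: x) star cnorm
}.

(* Unital complex C*-algebras; [algType] requires 1 != 0. *)
#[short(type="cstarAlgType")]
HB.structure Definition CstarAlgebra (R : realType) :=
  {A of GRing.Algebra R[i] A & isCstar R A}.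

Section MatrixAlgebra.
Context {R : realType} {A : cstarAlgType R}.

Definition mxstar n (x : 'M[A]_n) : 'M[A]_n := (map_mx star x)^T.

Definition mxpositive n (x : 'M[A]_n) : Prop := exists b, x = mxstar b *m b.

(* [N] makes the *-algebra M_n(A) a C*-algebra.  The library's [*:] on
   ['M[A]_n] has scalars in A, so complex scalars act entrywise. *)
Definition mxcstar_norm n (N : 'M[A]_n -> R) : Prop :=
  is_cstar_norm (fun (c : R[i]) => map_mx (fun a : A => c *: a)) (@mxstar n) N.

(* "The" C*-norm of M_n(A): a C*-norm exists on M_n(A) and it is unique, so
   this is a definite description and [fun _ => 0] is a dummy default. *)
Definition mxnorm n : 'M[A]_n -> R := xget (fun _ => 0) (@mxcstar_norm n).

Definition mxset n (S : set A) : set 'M[A]_n :=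
  [set x | forall i j, S (x i j)].

Definition linear_subspace (S : set A) : Prop :=
  S 0 /\ forall (c : R[i]) x y, S x -> S y -> S (c *: x + y).

Definition operator_system (S : set A) : Prop :=
  [/\ S 1, linear_subspace S & forall x, S x -> S (star x)].

Definition norm_closed (S : set A) : Prop :=
  forall x, (forall e : R, 0 < e -> exists2 y, S y & cnorm (x - y) < e) -> S x.

Definition cstar_subalgebra (S : set A) : Prop :=
  [/\ operator_system S, (forall x y, S x -> S y -> S (x * y)) & norm_closed S].

Definition generated_cstar (X : set A) : set A := smallest cstar_subalgebra X.

Definition closed_ideal (B J : set A) : Prop :=
  [/\ J `<=` B, linear_subspace J, norm_closed J
    & forall b x, B b -> J x -> J (b * x) /\ J (x * b)].

(* The quotient map q : B -> B / J is completely isometric on X.  The C*-norm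
   of M_n(B / J) = M_n(B) / M_n(J) is the quotient norm, that is
   ||q_n(x)|| = inf { ||x + k|| : k in M_n(J) }; the norm of M_n(B) is the
   restriction of that of M_n(A). *)
Definition quotient_completely_isometric (J X : set A) : Prop :=
  forall n (x : 'M[A]_n), mxset X x ->
    inf [set mxnorm (x + k) | k in @mxset n J] = mxnorm x.

Definition boundary_ideal (X J : set A) : Prop :=
  closed_ideal (generated_cstar X) J /\ quotient_completely_isometric J X.

(* The largest boundary ideal J of X in C*(X), so that C*_e(X) = C*(X) / J. *)
Definition shilov_ideal (X J : set A) : Prop :=
  boundary_ideal X J /\ forall J', boundary_ideal X J' -> J' `<=` J.

Definition cstar_envelope_eq_generated (X : set A) : Prop :=
  forall J, shilov_ideal X J <-> J = [set 0].

End MatrixAlgebra.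

Section Maps.
Context {R : realType}.
Implicit Types A B : cstarAlgType R.

(* Maps between operator systems S of A and T of B are total functions A -> B
   whose values outside S are irrelevant. *)
Definition unital_linear_on A B (S : set A) (T : set B) (f : A -> B) : Prop :=
  [/\ f 1 = 1, (forall x, S x -> T (f x))
    & forall (c : R[i]) x y, S x -> S y -> f (c *: x + y) = c *: f x + f y].

Definition ucp_on A B (S : set A) (T : set B) (f : A -> B) : Prop :=
  unital_linear_on S T f /\
  forall n (x : 'M[A]_n), mxset S x -> mxpositive x -> mxpositive (map_mx f x).

Definition unital_complete_isometry_on A B (S : set A) (T : set B)
    (f : A -> B) : Prop :=
  unital_linear_on S T f /\
  forall n (x : 'M[A]_n), mxset S x -> mxnorm (map_mx f x) = mxnorm x.

Definition injective_operator_system B (S : set B) : Prop :=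
  operator_system S /\
  forall (A : cstarAlgType R) (T1 T2 : set A),
    operator_system T1 -> operator_system T2 -> T1 `<=` T2 ->
    forall f : A -> B, ucp_on T1 S f ->
      exists g : A -> B, ucp_on T2 S g /\ forall x, T1 x -> g x = f x.

Definition injective_cstar A : Prop := injective_operator_system [set: A].

(* [f] identifies A with a unital C*-subalgebra of B. *)
Definition cstar_inclusion A B (f : {lrmorphism A -> B}) : Prop :=
  (forall x, f (star x) = star (f x)) /\ (forall x, cnorm (f x) = cnorm x).

Definition injective_envelope (D E : cstarAlgType R)
    (iota : {lrmorphism D -> E}) : Prop :=
  [/\ cstar_inclusion iota, injective_cstar E
    & forall (B : cstarAlgType R) (S : set B), injective_operator_system S ->
      forall tau : D -> B, unital_complete_isometry_on [set: D] S tau ->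
      exists tau1 : E -> B, unital_complete_isometry_on [set: E] S tau1 /\
        forall d, tau1 (iota d) = tau d].

Section PseudoExpectation.
Context {C D E : cstarAlgType R}.
Variables (j : {lrmorphism D -> C}) (iota : {lrmorphism D -> E}).

Definition pseudo_expectation (Phi : C -> E) : Prop :=
  ucp_on [set: C] [set: E] Phi /\ forall d, Phi (j d) = iota d.

Definition faithful (Phi : C -> E) : Prop :=
  forall x, Phi (star x * x) = 0 -> x = 0.

Definition faithful_unique_pseudo_expectation_property : Prop :=
  exists Phi, unique pseudo_expectation Phi /\ faithful Phi.

Definition every_pseudo_expectation_faithful : Prop :=
  forall Phi, pseudo_expectation Phi -> faithful Phi.

Lemma faithful_unique_every_faithful :
  faithful_unique_pseudo_expectation_property ->
  every_pseudo_expectation_faithful.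
Proof. by move=> [Phi [[_ uPhi] fPhi]] Psi /uPhi <-. Qed.

End PseudoExpectation.
End Maps.

(* Main.v *)
Require Import Defs.
From HB Require Import structures.
From mathcomp Require Import all_boot all_order all_algebra.
From mathcomp Require Import complex.
From mathcomp Require Import all_classical all_reals all_analysis.
From mathcomp Require Import ring lra.
Set Implicit Arguments.
Unset Strict Implicit.
Unset Printing Implicit Defensive.
Import Order.TTheory GRing.Theory Num.Theory.
Local Open Scope classical_set_scope.
Local Open Scope ring_scope.

(** Let J be a boundary ideal of X; the point is that J = 0. The classical
    argument passes to the quotient q : C*(X) -> C*(X) / J. Since q is isometric
    on D, the inclusion of D in its injective envelope E extends from q(D) to
    C*(X) / J, and, composed with q, from C*(X) to C. This produces a
    pseudo-expectation Phi that kills J. For x in J it kills star x * x, so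
    faithfulness gives x = 0.

    The quotient algebra is avoided here. The same Phi is obtained by extending,
    from the operator system D + K of C to C itself, the map d + k |-> iota d,
    where K consists of the x such that both x and star x lie in J
    ([diag_part_ucp], [boundary_ideal_eq0]). Working with K rather than J makes
    D + K self-adjoint without an approximate unit for J, and K still contains
    star x * x for every x in J.

    What has to be shown is that d + k |-> d is positive on every M_n(D + K)
    ([boundary_mxpositive]). Positivity is read off from norms: a self-adjoint
    x is positive as soon as ||r - x|| <= r for some r, and conversely a
    positive x satisfies this for every r >= ||x||. If d + k >= 0 in M_n(C) and
    r = ||d + k||, the complete isometry of q on X gives
    ||r - d|| <= ||r - d - k|| <= r, hence d >= 0 in M_n(C), and finally d >= 0
    in M_n(D) by the same criterion.

    So the analytic content is the criterion above and the existence of a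
    C*-norm on M_n(A). For the criterion, one direction is a square root by
    successive approximation ([sqrt_one_sub], [ball_cpositive]); the other is
    the positivity of star b * b ([star_mul_cpositive]), which is proved from
    square roots alone, with no spectral theory. The C*-norm on M_n(A) is the
    operator norm on the Hilbert A-module A^n ([opnorm_mxcstar]), which rests on
    the Cauchy-Schwarz inequality ([ip_cauchy_schwarz]). *)

(** * Norm and involution *)

Section CstarBasics.
Context {R : realType} {A : cstarAlgType R}.
Implicit Types (x y z b c h s : A) (r t e : R).

Lemma cnorm_ge0 x : 0 <= cnorm x.
Proof. exact: cstar_norm_ge0 cnormP x. Qed.

Lemma cnorm0_eq0 x : cnorm x = 0 -> x = 0.
Proof. exact: cstar_norm_eq0 cnormP x. Qed.

Lemma cnormD x y : cnorm (x + y) <= cnorm x + cnorm y.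
Proof. exact: cstar_normD cnormP x y. Qed.

Lemma cnormM x y : cnorm (x * y) <= cnorm x * cnorm y.
Proof. exact: cstar_normM cnormP x y. Qed.

Lemma cnorm_starM x : cnorm (star x * x) = cnorm x ^+ 2.
Proof. exact: cstar_identity cnormP x. Qed.

Lemma cnormZ (a : R[i]) x :
  cnorm (a *: x) = ComplexField.Normc.normc a * cnorm x.
Proof. exact: cstar_normZ cnormP a x. Qed.

Lemma normc_real r : ComplexField.Normc.normc r%:C%C = `|r|.
Proof. by rewrite /= expr0n /= addr0 sqrtr_sqr. Qed.

Lemma cnormZr r x : cnorm (r%:C%C *: x) = `|r| * cnorm x.
Proof. by rewrite cnormZ normc_real. Qed.

Lemma cnorm0 : cnorm (0 : A) = 0.
Proof.
by rewrite -(scale0r (0 : A)) cnormZ ComplexField.Normc.normc0 mul0r.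
Qed.

Lemma cnormN x : cnorm (- x) = cnorm x.
Proof.
have -> : - x = ((-1)%:C)%C *: x by rewrite rmorphN rmorph1 scaleN1r.
by rewrite cnormZr normrN normr1 mul1r.
Qed.

Lemma cnormB x y : cnorm (x - y) <= cnorm x + cnorm y.
Proof. by rewrite -(cnormN y) cnormD. Qed.

Lemma cnormBC x y : cnorm (x - y) = cnorm (y - x).
Proof. by rewrite -cnormN opprB. Qed.

Lemma star0 : star (0 : A) = 0.
Proof. by apply: (addrI (star 0)); rewrite -starD !addr0. Qed.

Lemma starN x : star (- x) = - star x.
Proof. by apply: (addrI (star x)); rewrite -starD !subrr star0. Qed.

Lemma starB x y : star (x - y) = star x - star y.
Proof. by rewrite starD starN. Qed.

Lemma star1 : star (1 : A) = 1.
Proof. by rewrite -[LHS]mul1r -{1}(starK 1) -starM mul1r starK. Qed.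

Lemma starZr r x : star (r%:C%C *: x) = r%:C%C *: star x.
Proof. by rewrite starZ; congr (_ *: _); exact: conjc_real. Qed.

Lemma star_real r : star (r%:C%C%:A : A) = r%:C%C%:A.
Proof. by rewrite starZr star1. Qed.

Lemma cnorm_star x : cnorm (star x) = cnorm x.
Proof.
suff H y : cnorm y <= cnorm (star y).
  by apply/eqP; rewrite eq_le H -{2}(starK x) H.
have [->|/eqP y0] := eqVneq (cnorm y) 0; first exact: cnorm_ge0.
have yp : 0 < cnorm y by rewrite lt_neqAle cnorm_ge0 eq_sym andbT; apply/eqP.
by rewrite -(ler_pM2r yp) -expr2 -cnorm_starM cnormM.
Qed.

Lemma cnorm1 : cnorm (1 : A) = 1.
Proof.
have /eqP := cnorm_starM 1; rewrite star1 mul1r expr2 -subr_eq0.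
have -> : cnorm (1 : A) - cnorm (1 : A) * cnorm (1 : A)
  = cnorm (1 : A) * (1 - cnorm (1 : A)) by ring.
rewrite mulf_eq0 subr_eq0 => /orP[/eqP/cnorm0_eq0/eqP|/eqP //].
by rewrite oner_eq0.
Qed.

Lemma cnorm_real r : cnorm (r%:C%C%:A : A) = `|r|.
Proof. by rewrite cnormZr cnorm1 mulr1. Qed.

Lemma cnorm_sqr c : star c = c -> cnorm (c * c) = cnorm c ^+ 2.
Proof. by move=> cs; rewrite -cnorm_starM cs. Qed.

(** An inequality valid up to every multiple of e is valid: limits are handled
    through this lemma rather than through a topology on A. *)
Lemma eps_le0 r K : (forall e, 0 < e -> r <= K * e) -> r <= 0.
Proof.
move=> H; rewrite leNgt; apply/negP => r0.
have K0 : 0 < `|K| + 1 by rewrite ltr_wpDl.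
have e0 : 0 < r / (2 * (`|K| + 1)) by rewrite divr_gt0 // mulr_gt0.
have ed : r / (2 * (`|K| + 1)) * (2 * (`|K| + 1)) = r.
  by rewrite divfK ?gt_eqF ?mulr_gt0.
by have := H _ e0; have := ler_norm K; nra.
Qed.

Lemma cnorm_eps_eq0 x K : (forall e, 0 < e -> cnorm x <= K * e) -> x = 0.
Proof.
by move=> /eps_le0 H; apply: cnorm0_eq0; apply/eqP; rewrite eq_le H cnorm_ge0.
Qed.

End CstarBasics.

(** * Square roots by successive approximation *)

Section SquareRoot.
Context {R : realType}.

(** A fixed point y of this map satisfies (1 - y)^2 = 1 - h. *)
Definition sqrt_step (A : cstarAlgType R) (h y : A) : A :=
  (2^-1)%:C%C *: (h + y * y).

(** The scalar iteration with h = 1. It increases to 1 and its increments bound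
    those of the iteration in A, since [sqrt_step] has nonnegative
    coefficients. *)
Definition sqrt_majorant (n : nat) : R :=
  iter n (fun t => 2^-1 * (1 + t ^+ 2)) 0.

Lemma sqrt_majorant_bounds n :
  0 <= sqrt_majorant n <= 1 /\ sqrt_majorant n <= sqrt_majorant n.+1.
Proof.
elim: n => [|n [/andP[h0 h1] h2]] /=.
  by rewrite /sqrt_majorant /= expr0n /=; split; lra.
rewrite /sqrt_majorant /= -/(sqrt_majorant n) in h0 h1 h2 *.
set t := sqrt_majorant n in h0 h1 h2 *; set u := 2^-1 * (1 + t ^+ 2) in h2 *.
have ud : u * 2 = 1 + t * t by rewrite /u; field.
have -> : (0 <= u <= 1) by nra.
by split => //; nra.
Qed.

Lemma sqrt_majorant_sub n : sqrt_majorant n.+2 - sqrt_majorant n.+1 =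
  2^-1 * ((sqrt_majorant n.+1 - sqrt_majorant n) *
          (sqrt_majorant n.+1 + sqrt_majorant n)).
Proof.
have : sqrt_majorant n.+2 = 2^-1 * (1 + sqrt_majorant n.+1 ^+ 2) by [].
have : sqrt_majorant n.+1 = 2^-1 * (1 + sqrt_majorant n ^+ 2) by [].
move: (sqrt_majorant n) (sqrt_majorant n.+1) (sqrt_majorant n.+2) => a b c.
nra.
Qed.

Lemma sqrt_majorant_homo m n : (m <= n)%N -> sqrt_majorant m <= sqrt_majorant n.
Proof.
by apply: (homo_leq lexx le_trans) => k; have [] := sqrt_majorant_bounds k.
Qed.

Lemma sqrt_majorant_cauchy (e : R) : 0 < e ->
  exists K, forall m n, (K <= m)%N -> (m <= n)%N ->
    sqrt_majorant n - sqrt_majorant m < e.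
Proof.
move=> e0; have hs : has_sup (range sqrt_majorant).
  split; first by exists (sqrt_majorant 0); exists 0%N.
  by exists 1 => _ [n _ <-]; have [/andP[]] := sqrt_majorant_bounds n.
have [_ [K _ <-] HK] := sup_adherent e0 hs.
exists K => m n Km mn; have := sqrt_majorant_homo Km.
have : sqrt_majorant n <= sup (range sqrt_majorant).
  by apply: ub_le_sup; [case: hs | exists n].
by move: HK; lra.
Qed.

Context {A : cstarAlgType R}.
Implicit Types (x y z b c h s : A) (r t e : R).

Lemma sqr_sub x y : x * x - y * y = x * (x - y) + (x - y) * y.
Proof. by rewrite mulrBr mulrBl addrA subrK. Qed.

Lemma cnorm_sqr_sub x y :
  cnorm (x * x - y * y) <= cnorm (x - y) * (cnorm x + cnorm y).
Proof.
rewrite sqr_sub (le_trans (cnormD _ _)) // [leRHS]mulrDr lerD ?cnormM //.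
by rewrite mulrC cnormM.
Qed.

(** The increments of the iterates need not decrease geometrically when the norm
    of h is 1, but they are bounded by those of [sqrt_majorant], whose sum
    converges. The limit commutes with everything that commutes with h because
    each iterate does. *)
Lemma sqrt_one_sub h : star h = h -> cnorm h <= 1 ->
  exists y, [/\ star y = y, cnorm y <= 1,
    forall z, z * h = h * z -> z * y = y * z & (1 - y) * (1 - y) = 1 - h].
Proof.
move=> hs h1; pose y n := iter n (sqrt_step h) 0.
have yS n : y n.+1 = (2^-1)%:C%C *: (h + y n * y n) by [].
have half (x : A) : cnorm ((2^-1)%:C%C *: x) = 2^-1 * cnorm x.
  by rewrite cnormZr ger0_norm // invr_ge0.
have ys n : star (y n) = y n.
  by elim: n => [|n IH]; rewrite ?star0 // yS starZr starD hs starM IH.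
have yc n z : z * h = h * z -> z * y n = y n * z.
  move=> zh; elim: n => [|n IH]; first by rewrite /y /= mulr0 mul0r.
  by rewrite yS -scalerAr -scalerAl mulrDr mulrDl zh mulrA IH -mulrA IH mulrA.
have yn n : cnorm (y n) <= sqrt_majorant n.
  elim: n => [|n IH]; first by rewrite /y /= cnorm0.
  rewrite yS half /sqrt_majorant /= -/(sqrt_majorant n).
  rewrite ler_pM2l ?invr_gt0 // (le_trans (cnormD _ _)) // lerD //.
  by rewrite (le_trans (cnormM _ _)) // expr2 ler_pM ?cnorm_ge0.
have yd n : cnorm (y n.+1 - y n) <= sqrt_majorant n.+1 - sqrt_majorant n.
  elim: n => [|n IH].
    have y0 : y 0%N = 0 by [].
    rewrite yS y0 subr0 mulr0 addr0 half /sqrt_majorant /=.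
    by rewrite expr0n /= subr0 addr0 ler_pM2l ?invr_gt0.
  rewrite [y n.+2]yS {2}yS -scalerBr half opprD addrACA subrr add0r.
  rewrite sqrt_majorant_sub.
  rewrite ler_pM2l ?invr_gt0 // (le_trans (cnorm_sqr_sub _ _)) //.
  by rewrite ler_pM ?addr_ge0 ?cnorm_ge0 // lerD.
have ydd m n : (m <= n)%N ->
    cnorm (y n - y m) <= sqrt_majorant n - sqrt_majorant m.
  move=> /subnK <-; elim: (n - m)%N => [|k IH]; first by rewrite !subrr cnorm0.
  rewrite addSn -(subrK (y (k + m)%N) (y (k + m).+1)) -addrA.
  rewrite (le_trans (cnormD _ _)) //.
  by have := yd (k + m)%N; move: IH; lra.
have [l Hl] : exists l, forall e, 0 < e -> exists K, forall p,
    (K <= p)%N -> cnorm (y p - l) < e.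
  apply: (cstar_complete cnormP) => e e0.
  have [K HK] := sqrt_majorant_cauchy e0; exists K => p q Kp Kq.
  have [pq|/ltnW qp] := leqP p q.
    by rewrite cnormBC (le_lt_trans (ydd _ _ pq)) // HK.
  by rewrite (le_lt_trans (ydd _ _ qp)) // HK.
have {}Hl e : 0 < e -> exists p, cnorm (y p - l) < e /\ cnorm (y p.+1 - l) < e.
  by move=> /Hl [K HK]; exists K; rewrite !HK.
have y1 p : cnorm (y p) <= 1.
  by rewrite (le_trans (yn p)) //; have [/andP[]] := sqrt_majorant_bounds p.
have l1 : cnorm l <= 1.
  rewrite -subr_le0; apply: (@eps_le0 _ _ 1) => e e0; rewrite mul1r lerBlDr.
  have [p [/ltW Hp _]] := Hl e e0.
  rewrite -[l](subrK (y p)) (le_trans (cnormD _ _)) // cnormBC.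
  exact: lerD.
exists l; split=> //.
- apply/subr0_eq/(@cnorm_eps_eq0 _ _ _ 2) => e e0.
  have [p [/ltW Hp _]] := Hl e e0.
  have -> : star l - l = star (l - y p) + (y p - l).
    by rewrite starB ys addrA subrK.
  rewrite (le_trans (cnormD _ _)) // cnorm_star (cnormBC l).
  by move: Hp; lra.
- move=> z zh; apply/subr0_eq/(@cnorm_eps_eq0 _ _ _ (2 * cnorm z)) => e e0.
  have [p [/ltW Hp _]] := Hl e e0.
  have -> : z * l - l * z = (y p - l) * z - z * (y p - l).
    by rewrite mulrBl mulrBr (yc p z zh) opprB [RHS]addrC addrA subrK.
  rewrite (le_trans (cnormB _ _)) //.
  have := cnormM (y p - l) z; have := cnormM z (y p - l).
  have := cnorm_ge0 z; nra.
have ll : (2^-1)%:C%C *: (h + l * l) = l.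
  apply/subr0_eq/(@cnorm_eps_eq0 _ _ _ 2) => e e0.
  have [p [/ltW Hp /ltW Hp1]] := Hl e e0.
  have -> : (2^-1)%:C%C *: (h + l * l) - l =
     (2^-1)%:C%C *: (l * l - y p * y p) + (y p.+1 - l).
    by rewrite yS addrA -scalerDr; congr (_ *: _ - _);
      rewrite addrCA addrA [h + _]addrC addrA subrK addrC.
  rewrite (le_trans (cnormD _ _)) // half.
  have := cnorm_sqr_sub l (y p); rewrite (cnormBC l).
  have := cnorm_ge0 (y p - l); have := y1 p; nra.
have hl : h + l * l = l + l.
  rewrite -{3 4}ll -scalerDl -rmorphD /=.
  have -> : 2^-1 + 2^-1 = 1 :> R by field.
  by rewrite scale1r.
rewrite mulrBr mulr1 mulrBl mul1r opprB.
have -> : h = l + l - l * l by rewrite -hl addrK.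
by rewrite opprB opprD !addrA; congr (_ - _); rewrite addrAC.
Qed.

End SquareRoot.

(** * Positive elements *)

Section Positivity.
Context {R : realType} {A : cstarAlgType R}.
Implicit Types (x y z a b c d s : A) (r t e : R).
Local Notation sc r := ((r%:C)%C%:A : A).

Lemma scaler_real_addr r t x :
  (r%:C)%C *: x + (t%:C)%C *: x = ((r + t)%:C)%C *: x.
Proof. by rewrite -scalerDl rmorphD. Qed.

Lemma scaler_realA r t x : (r%:C)%C *: ((t%:C)%C *: x) = ((r * t)%:C)%C *: x.
Proof. by rewrite scalerA rmorphM. Qed.

Lemma scaler_real1 x : (1%:C)%C *: x = x.
Proof. by rewrite rmorph1 scale1r. Qed.

Lemma half_double x : ((2^-1 : R)%:C)%C *: (x + x) = x.
Proof.
rewrite scalerDr scaler_real_addr (_ : 2^-1 + 2^-1 = 1) ?scaler_real1 //.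
by field.
Qed.

(** The second conclusion is the same kind of bound as the hypothesis, so the
    square root c again has a square root. *)
Lemma sqrt_of_ball x r : star x = x -> 0 < r -> cnorm (sc r - x) <= r ->
  exists c, [/\ star c = c, cnorm (sc (Num.sqrt r) - c) <= Num.sqrt r,
    forall z, z * x = x * z -> z * c = c * z & c * c = x].
Proof.
move=> xs r0 xr; pose h := (r^-1%:C)%C *: (sc r - x).
have hs : star h = h by rewrite starZr starB star_real xs.
have h1 : cnorm h <= 1.
  by rewrite cnormZr ger0_norm ?invr_ge0 ?(ltW r0) // ler_pdivrMl // mulr1.
have [y [ys y1 yc yy]] := sqrt_one_sub hs h1.
have sr0 : 0 <= Num.sqrt r := sqrtr_ge0 r.
exists ((Num.sqrt r)%:C%C *: (1 - y)); split.
- by rewrite starZr starB star1 ys.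
- rewrite -scalerBr subKr cnormZr ger0_norm //.
  by rewrite -{2}(mulr1 (Num.sqrt r)) ler_wpM2l.
- move=> z zx; rewrite -scalerAr -scalerAl mulrBr mulrBl mulr1 mul1r yc //.
  rewrite -scalerAr -scalerAl mulrBr mulrBl -scalerAr -scalerAl mulr1 mul1r.
  by rewrite zx.
- rewrite -scalerAr -scalerAl yy scaler_realA -expr2 sqr_sqrtr ?(ltW r0) //.
  by rewrite /h scalerBr scaler_realA divff ?gt_eqF // scaler_real1 subKr.
Qed.

(** The element u = c + i s satisfies star u * u = r, hence has norm sqrt r, and
    c is its real part. *)
Lemma cnorm_sqr_le c s r :
  star c = c -> star s = s -> c * s = s * c -> 0 <= r ->
  c * c + s * s = sc r -> cnorm c ^+ 2 <= r.
Proof.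
move=> cs ss cm r0 cr; pose u := c + 'i *: s.
have us : star u = c - 'i *: s.
  rewrite starD cs starZ ss; congr (_ + _).
  by rewrite -scaleNr; congr (_ *: _); exact: conjCi.
have uu : cnorm u ^+ 2 = r.
  rewrite -cnorm_starM us mulrDr !mulrBl -!scalerAl -!scalerAr cm scalerA.
  have -> : ('i * 'i : R[i]) = -1 by rewrite -expr2 sqrCi.
  by rewrite scaleN1r opprK addrA subrK cr cnorm_real ger0_norm.
have cu : c = (2^-1%:C)%C *: (u + star u).
  by rewrite us /u addrACA subrr addr0 half_double.
rewrite -uu ler_pXn2r ?nnegrE ?cnorm_ge0 //.
rewrite {1}cu cnormZr ger0_norm ?invr_ge0 // ler_pdivrMl //.
by rewrite (le_trans (cnormD _ _)) // cnorm_star mulr_natl mulr2n.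
Qed.

(** r - c^2 is a square s^2 with s commuting with c, so [cnorm_sqr_le]
    applies to s. *)
Lemma cnorm_real_sub_sqr c r :
  star c = c -> cnorm c ^+ 2 <= r -> cnorm (sc r - c * c) <= r.
Proof.
move=> cs cr; have [r0|r0] := eqVneq r 0.
  move: cr; rewrite r0 exprn_even_le0 //= => /eqP/cnorm0_eq0 ->.
  by rewrite mulr0 scale0r subr0 cnorm0.
have rp : 0 < r by rewrite lt_neqAle eq_sym r0 (le_trans _ cr) // sqr_ge0.
have xs : star (sc r - c * c) = sc r - c * c.
  by rewrite starB star_real starM cs.
have [|s [ss _ scomm sx]] := sqrt_of_ball xs rp.
  by rewrite subKr cnorm_sqr.
have cm : c * (sc r - c * c) = (sc r - c * c) * c.
  by rewrite mulrBr mulrBl -scalerAr -scalerAl mulr1 mul1r mulrA.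
rewrite -sx cnorm_sqr //; apply: (cnorm_sqr_le ss cs) => //.
- by rewrite scomm.
- exact: ltW.
- by rewrite sx subrK.
Qed.

(** Positivity is defined by squares of self-adjoint elements, for which the
    cone property is easy; [cpositiveP] identifies it with star b * b. *)
Definition cpositive x := exists2 c, star c = c & x = c * c.

Lemma cpositive_sa x : cpositive x -> star x = x.
Proof. by case=> c cs ->; rewrite starM cs. Qed.

Lemma cpositive_ball x r : cpositive x -> cnorm x <= r -> cnorm (sc r - x) <= r.
Proof. by case=> c cs ->; rewrite cnorm_sqr // => /cnorm_real_sub_sqr ->. Qed.

Lemma cpositive0 : cpositive 0.
Proof. by exists 0; rewrite ?star0 ?mulr0. Qed.

Lemma ball_cpositive x r : star x = x -> cnorm (sc r - x) <= r -> cpositive x.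
Proof.
move=> xs xr; have [r0|r0] := eqVneq r 0.
  move: xr; rewrite r0 scale0r sub0r cnormN => xr.
  have -> : x = 0 by apply/cnorm0_eq0/eqP; rewrite eq_le xr cnorm_ge0.
  exact: cpositive0.
have rp : 0 < r by rewrite lt_neqAle eq_sym r0 (le_trans _ xr) // cnorm_ge0.
by have [c [cs _ _ <-]] := sqrt_of_ball xs rp xr; exists c.
Qed.

Lemma cpositiveD x y : cpositive x -> cpositive y -> cpositive (x + y).
Proof.
move=> px py; apply: (@ball_cpositive _ (cnorm x + cnorm y)).
  by rewrite starD !cpositive_sa.
rewrite -scaler_real_addr opprD addrACA (le_trans (cnormD _ _)) //.
by rewrite lerD // cpositive_ball.
Qed.

Lemma cpositive_sum n (F : 'I_n -> A) :
  (forall i, cpositive (F i)) -> cpositive (\sum_i F i).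
Proof.
by move=> FP; elim/big_ind: _ => //; [exact: cpositive0|exact: cpositiveD].
Qed.

Lemma cpositiveZ r x : 0 <= r -> cpositive x -> cpositive ((r%:C)%C *: x).
Proof.
move=> r0 [c cs ->]; exists ((Num.sqrt r)%:C%C *: c).
  by rewrite starZr cs.
by rewrite -scalerAr -scalerAl scaler_realA -[Num.sqrt r * _]expr2 sqr_sqrtr.
Qed.

Lemma cpositive_le_cnorm x r :
  cpositive x -> cnorm x <= r -> cpositive (sc r - x).
Proof.
move=> px xr; apply: (@ball_cpositive _ r); last by rewrite subKr.
by rewrite starB star_real cpositive_sa.
Qed.

Lemma cpositive_cnorm_le x r :
  0 <= r -> cpositive x -> cpositive (sc r - x) -> cnorm x <= r.
Proof.
move=> r0 [c cs xc] py; pose y := sc r - x.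
have t0 : 0 < cnorm y + 1 by rewrite ltr_wpDl ?cnorm_ge0.
have [|s [ss _ scomm sy]] := sqrt_of_ball (cpositive_sa py) t0.
  by rewrite cpositive_ball // lerDl.
rewrite xc cnorm_sqr //; apply: (cnorm_sqr_le cs ss) => //.
  apply: scomm; rewrite xc mulrBr mulrBl -scalerAr -scalerAl mulr1 mul1r.
  by rewrite mulrA.
by rewrite sy xc addrC subrK.
Qed.

Lemma cpositive_antisym x : cpositive x -> cpositive (- x) -> x = 0.
Proof.
move=> px nx; apply/cnorm0_eq0/eqP; rewrite eq_le cnorm_ge0 andbT.
by apply: cpositive_cnorm_le => //; rewrite scale0r sub0r.
Qed.

Lemma sqr_eq0 c : star c = c -> c * c = 0 -> c = 0.
Proof.
move=> cs cc; apply/cnorm0_eq0/eqP.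
by rewrite -sqrf_eq0 -cnorm_sqr // cc cnorm0.
Qed.

Lemma cpositive_add_eq0 x y : cpositive x -> cpositive y -> x + y = 0 -> x = 0.
Proof.
by move=> px py /addr0_eq xy; apply: cpositive_antisym => //; rewrite xy.
Qed.

Lemma star_mul_eq0 c : star c * c = 0 -> c = 0.
Proof.
by move=> cc; apply/cnorm0_eq0/eqP; rewrite -sqrf_eq0 -cnorm_starM cc cnorm0.
Qed.

(** With d = star c, twice the sum is (c + d)^2 + (i (c - d))^2. *)
Lemma cpositive_starM_symm c : cpositive (star c * c + c * star c).
Proof.
pose a := c + star c; pose b : A := 'i *: (c - star c).
have asa : star a = a by rewrite starD starK addrC.
have bs : star b = b.
  rewrite /b starZ starB starK -(opprB c (star c)) scalerN -scaleNr.
  by congr (_ *: _); rewrite conjCi opprK.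
have -> : star c * c + c * star c = (2^-1%:C)%C *: (a * a + b * b).
  have -> : a * a + b * b =
      (star c * c + c * star c) + (star c * c + c * star c).
    rewrite /a /b -scalerAr -scalerAl scalerA.
    have -> : ('i * 'i : R[i]) = -1 by rewrite -expr2 sqrCi.
    rewrite scaleN1r !mulrDr !mulrDl !mulrN !mulNr opprK !opprD !opprK.
    set p := c * c; set q := star c * star c; set m := c * star c.
    set k := star c * c.
    by rewrite addrACA (addrACA p) (addrACA m) !subrr add0r addr0 addrACA.
  by rewrite half_double.
by apply: cpositiveZ; rewrite ?invr_ge0 //; apply: cpositiveD;
  [exists a|exists b].
Qed.

(** For e = c m both - star e * e = (m^2)^2 and - e * star e = (c * star c)^2
    are squares, while star e * e + e * star e is positive; so all of these
    vanish. This takes the place of the usual comparison of the spectra of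
    star c * c and c * star c. *)
Lemma neg_sqr_star_mul c m : star m = m -> star c * c = - (m * m) -> c = 0.
Proof.
move=> ms cm; pose e := c * m.
have ee : star e * e = - ((m * m) * (m * m)).
  by rewrite /e starM ms mulrA -[m * star c * c]mulrA cm mulrN mulNr !mulrA.
have ee' : e * star e = - ((c * star c) * (c * star c)).
  rewrite /e starM ms -!mulrA [m * _]mulrA [star c * _]mulrA cm.
  by rewrite mulNr mulrN opprK.
have ps := cpositive_starM_symm e; rewrite ee ee' -opprD in ps.
have p1 : cpositive (m * m * (m * m)) by exists (m * m); rewrite ?starM ?ms.
have p2 : cpositive (c * star c * (c * star c)).
  by exists (c * star c); rewrite ?starM ?starK.
have /(cpositive_add_eq0 p1 p2)/sqr_eq0 mm0 :=
  cpositive_antisym (cpositiveD p1 p2) ps.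
by apply: star_mul_eq0; rewrite cm mm0 ?oppr0 // starM ms.
Qed.

(** With x = star b * b, a = |x| the square root of x^2 and n = a - x (twice the
    negative part of x), one has x n = - a n. With t the square root of a,
    star (b n) * (b n) = n x n = - (t n)^2, so b n = 0 by [neg_sqr_star_mul].
    Then t n = 0, n = 0 and x = a. *)
Lemma star_mul_cpositive b : cpositive (star b * b).
Proof.
pose x := star b * b; have xs : star x = x by rewrite starM starK.
pose r := cnorm (x * x) + 1; have r0 : 0 < r by rewrite ltr_wpDl ?cnorm_ge0.
have [||a [asa ar ac aa]] := @sqrt_of_ball (x * x) r _ r0.
- by rewrite starM xs.
- by apply: cpositive_ball; [exists x | rewrite lerDl].
have sr0 : 0 < Num.sqrt r by rewrite sqrtr_gt0.
have [t [ts _ tc tta]] := sqrt_of_ball asa sr0 ar.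
have xa : x * a = a * x by apply: ac; rewrite mulrA.
have atc : a * t = t * a by apply: tc.
have xt : x * t = t * x by apply: tc.
pose n := a - x; have ns : star n = n by rewrite starB asa xs.
have nt : n * t = t * n by rewrite mulrBr mulrBl atc xt.
have xn : x * n = - (a * n) by rewrite !mulrBr -aa -xa opprB.
have nxn : star (b * n) * (b * n) = - (t * n * (t * n)).
  rewrite starM ns -[LHS]mulrA [star b * _]mulrA -/x xn mulrN; congr (- _).
  by rewrite -tta -!mulrA [LHS]mulrA nt -[LHS]mulrA.
have bn : b * n = 0.
  by apply: neg_sqr_star_mul nxn; rewrite starM ns ts nt.
have tn : t * n = 0.
  apply: sqr_eq0; first by rewrite starM ns ts nt.
  by apply: oppr_inj; rewrite -nxn bn mulr0 oppr0.
have n0 : n = 0.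
  apply: sqr_eq0 => //; rewrite {1}/n mulrBl xn opprK -tta -!mulrA tn mulr0.
  by rewrite addr0.
have -> : star b * b = a by apply/eqP; rewrite eq_sym -subr_eq0; apply/eqP.
by exists t.
Qed.

Lemma cpositiveP x : cpositive x <-> exists b, x = star b * b.
Proof.
split=> [[c cs ->]|[b ->]]; last exact: star_mul_cpositive.
by exists c; rewrite cs.
Qed.

Lemma cpositive_conj a x : cpositive x -> cpositive (star a * x * a).
Proof.
case=> c cs ->; apply/cpositiveP; exists (c * a).
by rewrite starM cs !mulrA.
Qed.

Lemma cnorm_cpositive_homo x y :
  cpositive x -> cpositive (y - x) -> cnorm x <= cnorm y.
Proof.
move=> px pyx; have py : cpositive y by rewrite -(subrK x y); exact: cpositiveD.
apply: cpositive_cnorm_le => //; first exact: cnorm_ge0.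
rewrite -[_ - x](subrKA y).
by apply: cpositiveD => //; exact: cpositive_le_cnorm.
Qed.

End Positivity.

(** * The C*-norm of M_n(A): the operator norm on the Hilbert module A^n *)

Section HilbertModule.
Context {R : realType} {A : cstarAlgType R} {n : nat}.
Implicit Types (u v w : 'cV[A]_n) (a b : A) (x y : 'M[A]_n) (r t M : R).

Lemma star_sum (I : finType) (F : I -> A) :
  star (\sum_i F i) = \sum_i star (F i).
Proof. exact: (big_morph _ (@starD _ A) star0). Qed.

Lemma cnorm_sum (I : finType) (F : I -> A) :
  cnorm (\sum_i F i) <= \sum_i cnorm (F i).
Proof.
elim/big_ind2: _ => // [|p q s t pq st]; first by rewrite cnorm0.
by rewrite (le_trans (cnormD _ _)) // lerD.
Qed.

Definition ip v w : A := \sum_i star (v i 0) * w i 0.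

Lemma star_ip v w : star (ip v w) = ip w v.
Proof. by rewrite star_sum; apply: eq_bigr => i _; rewrite starM starK. Qed.

Lemma ipDr u v w : ip u (v + w) = ip u v + ip u w.
Proof. by rewrite -big_split; apply: eq_bigr => i _; rewrite mxE mulrDr. Qed.

Lemma ipDl u v w : ip (u + v) w = ip u w + ip v w.
Proof. by rewrite -star_ip ipDr starD !star_ip. Qed.

Lemma ip_cpositive v : cpositive (ip v v).
Proof. by apply: cpositive_sum => i; exact: star_mul_cpositive. Qed.

Lemma ip_adjoint x v w : ip v (x *m w) = ip (mxstar x *m v) w.
Proof.
transitivity (\sum_i \sum_j star (v i 0) * (x i j * w j 0)).
  by apply: eq_bigr => i _; rewrite mxE mulr_sumr.
rewrite exchange_big; apply: eq_bigr => j _ /=.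
rewrite mxE star_sum mulr_suml; apply: eq_bigr => i _.
by rewrite !mxE starM starK mulrA.
Qed.

Definition rscale v a : 'cV[A]_n := \col_i (v i 0 * a).

Lemma ip_rscaler v w a : ip v (rscale w a) = ip v w * a.
Proof. by rewrite /ip mulr_suml; apply: eq_bigr => i _; rewrite mxE mulrA. Qed.

Lemma ip_rscalel v w a : ip (rscale v a) w = star a * ip v w.
Proof. by rewrite -star_ip ip_rscaler starM star_ip. Qed.

Definition hnorm v : R := Num.sqrt (cnorm (ip v v)).

Lemma hnorm_ge0 v : 0 <= hnorm v.
Proof. exact: sqrtr_ge0. Qed.

Lemma hnorm_sqr v : hnorm v ^+ 2 = cnorm (ip v v).
Proof. by rewrite sqr_sqrtr // cnorm_ge0. Qed.

Lemma cnorm_le_hnorm v i : cnorm (v i 0) <= hnorm v.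
Proof.
rewrite -(@ler_pXn2r _ 2) ?nnegrE ?hnorm_ge0 ?cnorm_ge0 //.
rewrite hnorm_sqr -cnorm_starM; apply: cnorm_cpositive_homo.
  exact: star_mul_cpositive.
rewrite /ip (bigD1 i) //= [X in X - _]addrC addrK big_mkcond /=.
apply: cpositive_sum => k; case: ifP => _; first exact: star_mul_cpositive.
exact: cpositive0.
Qed.

Lemma hnorm_le_sum v : hnorm v <= \sum_i cnorm (v i 0).
Proof.
have s0 : 0 <= \sum_i cnorm (v i 0) by apply: sumr_ge0 => i _; exact: cnorm_ge0.
rewrite -(@ler_pXn2r _ 2) ?nnegrE ?hnorm_ge0 // hnorm_sqr.
rewrite (le_trans (cnorm_sum _)) // expr2 mulr_suml.
apply: ler_sum => i _; rewrite cnorm_starM expr2 ler_wpM2l ?cnorm_ge0 //.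
by rewrite (bigD1 i) //= lerDl; apply: sumr_ge0 => k _; exact: cnorm_ge0.
Qed.

(** For a = <v, w> and V = ||<v, v>||, expanding <u, u> >= 0 with u = v a - V w
    gives V (star a * a) <= V^2 <w, w>, because
    star a * <v, v> * a <= V (star a * a). The estimate then follows from
    monotonicity of the norm on positive elements. *)
Lemma ip_cauchy_schwarz v w : cnorm (ip v w) <= hnorm v * hnorm w.
Proof.
rewrite -(@ler_pXn2r _ 2) ?nnegrE ?mulr_ge0 ?hnorm_ge0 ?cnorm_ge0 //.
rewrite exprMn !hnorm_sqr; set V := cnorm (ip v v); set a := ip v w.
have [V0|V0] := eqVneq V 0.
  (* V = 0 cannot be divided out, but it forces v = 0 *)
  suff -> : a = 0 by rewrite cnorm0 expr0n /= mulr_ge0 ?cnorm_ge0.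
  apply: big1 => i _; have := cnorm_le_hnorm v i.
  rewrite /hnorm -/V V0 sqrtr0 => vi.
  have -> : v i 0 = 0 by apply/cnorm0_eq0/eqP; rewrite eq_le vi cnorm_ge0.
  by rewrite star0 mul0r.
have Vp : 0 < V by rewrite lt_neqAle eq_sym V0 cnorm_ge0.
rewrite -cnorm_starM -[V]ger0_norm ?cnorm_ge0 // -cnormZr.
apply: cnorm_cpositive_homo; first exact: star_mul_cpositive.
pose u := rscale v a + rscale w (- (V%:C)%C%:A).
have uu : ip u u = star a * ip v v * a - (V%:C)%C *: (star a * a)
    - (V%:C)%C *: (star a * a) + ((V * V)%:C)%C *: ip w w.
  rewrite /u !ipDr !ipDl !ip_rscaler !ip_rscalel starN star_real.
  rewrite -(star_ip v w) -/a !mulrN !mulNr opprK !mulr_algr !mulr_algl.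
  by rewrite -scalerAl scaler_realA !addrA.
rewrite -(scaler_real1 (_ - _)) -(@mulVf _ V) // -scaler_realA.
apply: cpositiveZ; first by rewrite invr_ge0 ltW.
have -> : (V%:C)%C *: ((V%:C)%C *: ip w w - star a * a) =
    ip u u + (star a * ((V%:C)%C%:A - ip v v) * a).
  rewrite uu mulrBr mulrBl mulr_algr -scalerAl scalerBr scaler_realA.
  set p := star a * _ * a; set q := _ *: (star a * a); set s := _ *: ip w w.
  rewrite -(opprB q p); move: (q - p) => d.
  by rewrite [RHS]addrC !addrA subrr sub0r [RHS]addrC.
apply: cpositiveD; first exact: ip_cpositive.
by apply/cpositive_conj/cpositive_le_cnorm => //; exact: ip_cpositive.
Qed.

Lemma hnormD v w : hnorm (v + w) <= hnorm v + hnorm w.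
Proof.
rewrite -(@ler_pXn2r _ 2) ?nnegrE ?addr_ge0 ?hnorm_ge0 //.
rewrite hnorm_sqr ipDr !ipDl sqrrD !hnorm_sqr.
have := ip_cauchy_schwarz v w.
have := cnormD (ip v v + ip w v) (ip v w + ip w w).
have := cnormD (ip v v) (ip w v); have := cnormD (ip v w) (ip w w).
by rewrite -(cnorm_star (ip w v)) star_ip; lra.
Qed.

Lemma hnormZ (c : R[i]) v :
  hnorm (map_mx (fun a => c *: a) v) = ComplexField.Normc.normc c * hnorm v.
Proof.
rewrite /hnorm.
have -> : ip (map_mx (fun a => c *: a) v) (map_mx (fun a => c *: a) v) =
    (Num.conj c * c) *: ip v v.
  rewrite scaler_sumr; apply: eq_bigr => i _.
  by rewrite mxE starZ -scalerAl -scalerAr scalerA.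
have cc : ComplexField.Normc.normc (Num.conj c) = ComplexField.Normc.normc c.
  by case: c => c d; rewrite /= sqrrN.
have c0 : 0 <= ComplexField.Normc.normc c by case: (c) => p q; exact: sqrtr_ge0.
rewrite cnormZ ComplexField.Normc.normcM cc -expr2 sqrtrM ?sqr_ge0 //.
by rewrite sqrtr_sqr ger0_norm.
Qed.

Lemma hnorm_mulmx_le_sum x v :
  hnorm (x *m v) <= (\sum_i \sum_j cnorm (x i j)) * hnorm v.
Proof.
rewrite (le_trans (hnorm_le_sum _)) // mulr_suml ler_sum // => i _.
rewrite mxE (le_trans (cnorm_sum _)) // mulr_suml ler_sum // => j _.
by rewrite (le_trans (cnormM _ _)) // ler_wpM2l ?cnorm_ge0 // cnorm_le_hnorm.
Qed.

Definition opbound x : set R :=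
  [set M | 0 <= M /\ forall v, hnorm (x *m v) <= M * hnorm v].

Definition opnorm x : R := inf (opbound x).

Lemma opbound_neq0 x : opbound x !=set0.
Proof.
exists (\sum_i \sum_j cnorm (x i j)); split; last exact: hnorm_mulmx_le_sum.
by apply: sumr_ge0 => i _; apply: sumr_ge0 => j _; exact: cnorm_ge0.
Qed.

Lemma opnorm_ge0 x : 0 <= opnorm x.
Proof. by apply: lb_le_inf => [|M []//]; exact: opbound_neq0. Qed.

Lemma opnorm_le x M :
  0 <= M -> (forall v, hnorm (x *m v) <= M * hnorm v) -> opnorm x <= M.
Proof. by move=> M0 xM; apply: ge_inf => //; exists 0 => t []. Qed.

Lemma hnorm_mulmx x v : hnorm (x *m v) <= opnorm x * hnorm v.
Proof.
have [v0|v0] := eqVneq (hnorm v) 0.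
  have [M [_ /(_ v)]] := opbound_neq0 x.
  by rewrite v0 !mulr0.
have vp : 0 < hnorm v by rewrite lt_neqAle eq_sym v0 hnorm_ge0.
rewrite -ler_pdivrMr //; apply: lb_le_inf; first exact: opbound_neq0.
by move=> M [_ xM]; rewrite ler_pdivrMr.
Qed.

Lemma opnorm_le_sum x : opnorm x <= \sum_i \sum_j cnorm (x i j).
Proof.
apply: opnorm_le; last exact: hnorm_mulmx_le_sum.
by apply: sumr_ge0 => i _; apply: sumr_ge0 => j _; exact: cnorm_ge0.
Qed.

Lemma cnorm_le_opnorm x i j : cnorm (x i j) <= opnorm x.
Proof.
pose e : 'cV[A]_n := delta_mx j 0.
have e1 : hnorm e = 1.
  rewrite /hnorm /ip (bigD1 j) //= big1 => [|k kj]; rewrite !mxE ?eqxx /=.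
    by rewrite star1 mulr1 addr0 cnorm1 sqrtr1.
  by rewrite (negPf kj) mulr0.
have := hnorm_mulmx x e; rewrite e1 mulr1; apply: le_trans.
have -> : x i j = (x *m e) i 0 by rewrite -colE mxE.
exact: cnorm_le_hnorm.
Qed.

Lemma opnormM x y : opnorm (x *m y) <= opnorm x * opnorm y.
Proof.
apply: opnorm_le => [|v]; first by rewrite mulr_ge0 ?opnorm_ge0.
rewrite -mulmxA (le_trans (hnorm_mulmx _ _)) // -mulrA.
by rewrite ler_wpM2l ?opnorm_ge0 // hnorm_mulmx.
Qed.

(** ||x v||^2 is the norm of <star x * x v, v>; Cauchy-Schwarz applies. *)
Lemma opnorm_sqr_le x : opnorm x ^+ 2 <= opnorm (mxstar x *m x).
Proof.
rewrite -[leRHS]sqr_sqrtr ?opnorm_ge0 //.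
rewrite ler_pXn2r ?nnegrE ?opnorm_ge0 ?sqrtr_ge0 //.
apply: opnorm_le => [|v]; first exact: sqrtr_ge0.
rewrite -(@ler_pXn2r _ 2) ?nnegrE ?mulr_ge0 ?hnorm_ge0 ?sqrtr_ge0 //.
rewrite hnorm_sqr exprMn [X in _ <= X * _]sqr_sqrtr ?opnorm_ge0 //.
rewrite ip_adjoint mulmxA.
rewrite (le_trans (ip_cauchy_schwarz _ _)) // expr2 mulrA.
by rewrite ler_wpM2r ?hnorm_ge0 // hnorm_mulmx.
Qed.

Lemma mxstarK x : mxstar (mxstar x) = x.
Proof. by apply/matrixP => i j; rewrite !mxE starK. Qed.

Lemma opnorm_star x : opnorm (mxstar x) = opnorm x.
Proof.
suff H y : opnorm y <= opnorm (mxstar y).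
  by apply/eqP; rewrite eq_le H -{2}(mxstarK x) H.
have [->|y0] := eqVneq (opnorm y) 0; first exact: opnorm_ge0.
have yp : 0 < opnorm y by rewrite lt_neqAle eq_sym y0 opnorm_ge0.
rewrite -(ler_pM2r yp) -expr2.
exact: le_trans (opnorm_sqr_le y) (opnormM _ _).
Qed.

Lemma opnormZ_le (c : R[i]) x :
  opnorm (map_mx (fun a => c *: a) x) <= ComplexField.Normc.normc c * opnorm x.
Proof.
have c0 : 0 <= ComplexField.Normc.normc c by case: (c) => p q; exact: sqrtr_ge0.
apply: opnorm_le => [|v]; first by rewrite mulr_ge0 ?opnorm_ge0.
have -> : map_mx (fun a => c *: a) x *m v = map_mx (fun a => c *: a) (x *m v).
  apply/matrixP => i j; rewrite !mxE scaler_sumr; apply: eq_bigr => k _.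
  by rewrite mxE scalerAl.
by rewrite hnormZ -mulrA ler_wpM2l // hnorm_mulmx.
Qed.

Lemma opnormZ (c : R[i]) x :
  opnorm (map_mx (fun a => c *: a) x) = ComplexField.Normc.normc c * opnorm x.
Proof.
apply/eqP; rewrite eq_le opnormZ_le /=.
have [->|c0] := eqVneq c 0.
  by rewrite ComplexField.Normc.normc0 mul0r opnorm_ge0.
have n0 : ComplexField.Normc.normc c != 0.
  by apply: contra c0 => /eqP/ComplexField.Normc.eq0_normc ->.
have np : 0 < ComplexField.Normc.normc c.
  by rewrite lt_neqAle eq_sym n0; case: (c) => p q; exact: sqrtr_ge0.
rewrite -ler_pdivlMl // -ComplexField.Normc.normcV.
apply: le_trans (opnormZ_le _ _).
rewrite le_eqVlt; apply/orP; left; apply/eqP; congr opnorm.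
by apply/matrixP => i j; rewrite !mxE scalerA mulVf // scale1r.
Qed.

(** The operator norm lies between the largest norm of an entry and the sum of
    the norms of all entries, so convergence is entrywise convergence. *)
Lemma opnorm_complete : norm_complete opnorm.
Proof.
move=> u uC.
have H i j : exists l, forall e : R, 0 < e -> exists K, forall p,
    (K <= p)%N -> cnorm (u p i j - l) < e.
  apply: (cstar_complete cnormP) => e /uC [K HK]; exists K => p q Kp Kq.
  apply: le_lt_trans (HK p q Kp Kq).
  have -> : u p i j - u q i j = (u p - u q) i j by rewrite !mxE.
  exact: cnorm_le_opnorm.
pose l : 'M[A]_n := \matrix_(i, j) projT1 (cid (H i j)).
have Hl i j : forall e : R, 0 < e -> exists K, forall p,
    (K <= p)%N -> cnorm (u p i j - l i j) < e.
  by rewrite mxE; case: cid.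
(* one more than the number of entries: a strict bound, and no division by 0 *)
exists l => e e0; pose d := e / (n * n).+1%:R.
have d0 : 0 < d by rewrite divr_gt0.
pose K i j := projT1 (cid (Hl i j d d0)).
exists (\max_i \max_j K i j)%N => p Kp.
apply: le_lt_trans (opnorm_le_sum _) _.
apply: (@le_lt_trans _ _ (\sum_(i < n) \sum_(j < n) d)).
  apply: ler_sum => i _; apply: ler_sum => j _; rewrite ltW //.
  have -> : (u p - l) i j = u p i j - l i j by rewrite !mxE.
  have : (K i j <= p)%N.
    apply: leq_trans Kp; apply: leq_trans (leq_bigmax i).
    exact: (leq_bigmax j).
  by rewrite /K; case: cid => k /= Hk /Hk.
rewrite !sumr_const !card_ord -mulrnA -mulr_natr.
have <- : d * (n * n).+1%:R = e by rewrite divfK // pnatr_eq0.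
by rewrite ltr_pM2l // ltr_nat.
Qed.

Lemma opnorm_mxcstar : mxcstar_norm opnorm.
Proof.
split.
- exact: opnorm_ge0.
- move=> x x0; apply/matrixP => i j; rewrite mxE; apply/cnorm0_eq0/eqP.
  by rewrite eq_le cnorm_ge0 -x0 cnorm_le_opnorm.
- move=> x y; apply: opnorm_le => [|v]; first by rewrite addr_ge0 ?opnorm_ge0.
  by rewrite mulmxDl (le_trans (hnormD _ _)) // mulrDl lerD // hnorm_mulmx.
- exact: opnormZ.
- exact: opnormM.
- move=> x; apply/eqP; rewrite eq_le opnorm_sqr_le andbT.
  by rewrite (le_trans (opnormM _ _)) // opnorm_star expr2.
- exact: opnorm_complete.
Qed.

(** A C*-norm exists, so [mxnorm] is one and not the default value 0. *)
Lemma mxnorm_mxcstar : mxcstar_norm (@mxnorm _ A n).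
Proof. exact: (xgetPex _ (ex_intro _ _ opnorm_mxcstar)). Qed.

End HilbertModule.

(** * Positive matrices *)

Section MatrixCstarAlgebra.
Context {R : realType} {A : cstarAlgType R}.

Lemma mxstarD n (x y : 'M[A]_n) : mxstar (x + y) = mxstar x + mxstar y.
Proof. by apply/matrixP => i j; rewrite !mxE starD. Qed.

Lemma mxstarM n (x y : 'M[A]_n) : mxstar (x *m y) = mxstar y *m mxstar x.
Proof.
apply/matrixP => i j; rewrite !mxE star_sum; apply: eq_bigr => k _.
by rewrite !mxE starM.
Qed.

Definition mxcscale n (c : R[i]) : 'M[A]_n -> 'M[A]_n :=
  map_mx (fun a : A => c *: a).

(** A copy of M_n(A), n > 0, carrying complex scalars and a chosen C*-norm, so
    that the results on C*-algebras apply to matrices. *)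
Definition mxcstar n (N : 'M[A]_n.+1 -> R) of mxcstar_norm N : Type :=
  'M[A]_n.+1.

Section Instance.
Context {n : nat} {N : 'M[A]_n.+1 -> R} (hN : mxcstar_norm N).
Local Notation T := (mxcstar hN).

HB.instance Definition _ := GRing.NzRing.copy T 'M[A]_n.+1.

Lemma mxcscaleA (c d : R[i]) (x : T) :
  mxcscale c (mxcscale d x) = mxcscale (c * d) x.
Proof. by apply/matrixP => i j; rewrite !mxE scalerA. Qed.

Lemma mxcscale1 : left_id 1 (@mxcscale n.+1).
Proof. by move=> x; apply/matrixP => i j; rewrite !mxE scale1r. Qed.

Lemma mxcscaleDr : right_distributive (@mxcscale n.+1) +%R.
Proof. by move=> c x y; apply/matrixP => i j; rewrite !mxE scalerDr. Qed.

Lemma mxcscaleDl (x : T) : {morph (fun c => mxcscale c x : T) : a b / a + b}.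
Proof. by move=> c d; apply/matrixP => i j; rewrite !mxE scalerDl. Qed.

HB.instance Definition _ :=
  GRing.Zmodule_isLmodule.Build R[i] T
    mxcscaleA mxcscale1 mxcscaleDr mxcscaleDl.

Lemma mxcscaleAl (c : R[i]) (x y : T) : c *: (x * y) = (c *: x) * y.
Proof.
apply/matrixP => i j; rewrite !mxE scaler_sumr; apply: eq_bigr => k _.
by rewrite mxE scalerAl.
Qed.

HB.instance Definition _ := GRing.Lmodule_isLalgebra.Build R[i] T mxcscaleAl.

Lemma mxcscaleAr (c : R[i]) (x y : T) : c *: (x * y) = x * (c *: y).
Proof.
apply/matrixP => i j; rewrite !mxE scaler_sumr; apply: eq_bigr => k _.
by rewrite mxE scalerAr.
Qed.

HB.instance Definition _ := GRing.Lalgebra_isAlgebra.Build R[i] T mxcscaleAr.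

Lemma mxstarZ (c : R[i]) (x : T) :
  mxstar (c *: x : T) = Num.conj c *: (mxstar x : T).
Proof. by apply/matrixP => i j; rewrite !mxE starZ. Qed.

HB.instance Definition _ := isCstar.Build R T
  (@mxstarK _ _ _) (@mxstarD _) mxstarZ (@mxstarM _) hN.

End Instance.

(** This and [ball_mxpositive] are the two halves of the norm criterion for
    positivity, for any C*-norm on matrices. Two C*-norms, or the norms of an
    algebra and of a subalgebra, are compared through them. *)
Lemma mxpositive_ball n (N : 'M[A]_n -> R) (x : 'M[A]_n) (r : R) :
  mxcstar_norm N -> mxpositive x -> N x <= r ->
  N (mxcscale (r%:C)%C 1%:M - x) <= r.
Proof.
case: n N x => [|n] N x hN.
  by move=> _; rewrite [_ - x]flatmx0 [x]flatmx0.
move=> [b xb]; apply: (@cpositive_ball _ (mxcstar hN)).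
by rewrite xb; exact: (@star_mul_cpositive _ (mxcstar hN)).
Qed.

Lemma ball_mxpositive n (N : 'M[A]_n -> R) (x : 'M[A]_n) (r : R) :
  mxcstar_norm N -> mxstar x = x -> N (mxcscale (r%:C)%C 1%:M - x) <= r ->
  mxpositive x.
Proof.
case: n N x => [|n] N x hN xs xr.
  by exists 0; rewrite [LHS]flatmx0 [RHS]flatmx0.
have [//|c cs xc] := @ball_cpositive _ (mxcstar hN) x r xs.
by exists c; rewrite {1}xc -{1}cs.
Qed.

End MatrixCstarAlgebra.

(** * Inclusions reflect positivity *)

Section Inclusion.
Context {R : realType} {A B : cstarAlgType R} (f : {lrmorphism A -> B}).
Hypothesis fP : cstar_inclusion f.

Lemma inclusion_inj : injective f.
Proof.
move=> x y xy; apply/subr0_eq/cnorm0_eq0.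
by rewrite -fP.2 rmorphB /= xy subrr cnorm0.
Qed.

Lemma inclusion_mx_inj m n :
  injective (map_mx f : 'M[A]_(m, n) -> 'M[B]_(m, n)).
Proof.
move=> x y /matrixP xy; apply/matrixP => i k; apply: inclusion_inj.
by have := xy i k; rewrite !mxE.
Qed.

Lemma inclusion_mxstar n (x : 'M[A]_n) :
  map_mx f (mxstar x) = mxstar (map_mx f x).
Proof. by apply/matrixP => i k; rewrite !mxE fP.1. Qed.

Lemma inclusion_mxpositive n (x : 'M[A]_n) :
  mxpositive x -> mxpositive (map_mx f x).
Proof.
by case=> b ->; exists (map_mx f b); rewrite map_mxM inclusion_mxstar.
Qed.

Lemma inclusion_hnorm n (v : 'cV[A]_n) : hnorm (map_mx f v) = hnorm v.
Proof.
rewrite /hnorm -fP.2 /ip rmorph_sum; congr (Num.sqrt (cnorm _)).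
by apply: eq_bigr => i _; rewrite !mxE rmorphM /= fP.1.
Qed.

(** A matrix over B acts on more vectors than those coming from A. *)
Lemma inclusion_opnorm_le n (x : 'M[A]_n) : opnorm x <= opnorm (map_mx f x).
Proof.
apply: opnorm_le => [|v]; first exact: opnorm_ge0.
by rewrite -!(inclusion_hnorm v) -inclusion_hnorm map_mxM hnorm_mulmx.
Qed.

Lemma inclusion_mxcscale n c (x : 'M[A]_n) :
  map_mx f (mxcscale c x) = mxcscale c (map_mx f x).
Proof. by apply/matrixP => i k; rewrite !mxE linearZ. Qed.

(** The norm criterion passes from M_n(B) to M_n(A) because the operator norm
    can only decrease when fewer vectors are tested. *)
Lemma inclusion_mxpositive_reflect n (x : 'M[A]_n) :
  mxpositive (map_mx f x) -> mxpositive x.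
Proof.
move=> px; have xs : mxstar x = x.
  apply: inclusion_mx_inj; rewrite inclusion_mxstar.
  by have [b ->] := px; rewrite mxstarM mxstarK.
apply: (ball_mxpositive opnorm_mxcstar xs).
apply: le_trans (mxpositive_ball opnorm_mxcstar px (lexx _)).
rewrite (le_trans (inclusion_opnorm_le _)) //.
by rewrite map_mxB inclusion_mxcscale map_mx1.
Qed.

End Inclusion.

(** * Boundary ideals vanish *)

Section BoundaryIdeal.
Context {R : realType} {C D E : cstarAlgType R}.
Variables (j : {lrmorphism D -> C}) (iota : {lrmorphism D -> E}).
Hypotheses (jP : cstar_inclusion j) (iotaP : cstar_inclusion iota).
Variables (X J : set C).
Hypotheses (jX : range j `<=` X) (XJ : boundary_ideal X J).

Lemma linear_subspaceN (S : set C) x : linear_subspace S -> S x -> S (- x).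
Proof. by move=> [S0 SL] Sx; rewrite -[- x]addr0 -scaleN1r; exact: SL. Qed.

Lemma linear_subspaceD (S : set C) x y :
  linear_subspace S -> S x -> S y -> S (x + y).
Proof. by move=> [S0 SL] Sx Sy; rewrite -[x]scale1r; exact: SL. Qed.

Lemma boundary_mxnorm_le n (x k : 'M[C]_n) :
  mxset X x -> mxset J k -> mxnorm x <= mxnorm (x + k).
Proof.
move=> Xx Jk; rewrite -{1}(XJ.2 n x Xx); apply: ge_inf; last by exists k.
by exists 0 => _ [h _ <-]; exact: (cstar_norm_ge0 mxnorm_mxcstar).
Qed.

(** Complete isometry at size 1: x and x - x have the same norm modulo J. *)
Lemma boundary_ideal_disjoint x : X x -> J x -> x = 0.
Proof.
have [_ linJ _ _] := XJ.1.
move=> Xx Jx; pose m : 'M[C]_1 := const_mx x.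
have m0 : m = 0.
  apply: (cstar_norm_eq0 mxnorm_mxcstar); apply/eqP.
  rewrite eq_le (cstar_norm_ge0 mxnorm_mxcstar) andbT.
  have <- : mxnorm (m - m) = 0.
    rewrite subrr; have := cstar_normZ mxnorm_mxcstar 0 (0 : 'M[C]_1).
    by rewrite map_mx0 ?scaler0 // ComplexField.Normc.normc0 mul0r.
  apply: boundary_mxnorm_le => i k; rewrite !mxE //.
  exact: linear_subspaceN.
by move/matrixP/(_ 0 0): m0; rewrite !mxE.
Qed.

(** That J itself is self-adjoint takes an approximate unit; this part of J is
    self-adjoint by construction and contains star x * x for every x in J. *)
Definition sa_part : set C := [set x | J x /\ J (star x)].

(** With r = ||x + k||, the chain ||r - x|| <= ||r - x - k|| <= r shows that x
    is positive. It is self-adjoint because its skew part lies in J, which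
    meets X only in 0. *)
Lemma boundary_mxpositive n (x : 'M[D]_n) (k : 'M[C]_n) :
  mxset sa_part k -> mxpositive (map_mx j x + k) -> mxpositive x.
Proof.
have [_ linJ _ _] := XJ.1.
move=> Jk pxk; apply: (inclusion_mxpositive_reflect jP).
have jxs : mxstar (map_mx j x) = map_mx j x.
  have sxk : mxstar (map_mx j x + k) = map_mx j x + k.
    by have [b ->] := pxk; rewrite mxstarM mxstarK.
  apply/matrixP => a b; apply/subr0_eq; apply: boundary_ideal_disjoint.
    apply: jX; exists (star (x b a) - x a b) => //.
    by rewrite rmorphB /= !mxE jP.1.
  move/matrixP/(_ a b): sxk; rewrite mxstarD !mxE.
  move/eqP; rewrite -subr_eq0 opprD addrACA addr_eq0 opprB => /eqP ->.
  apply: linear_subspaceD => //; first by have [] := Jk a b.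
  by apply: linear_subspaceN => //; have [] := Jk b a.
have := mxpositive_ball mxnorm_mxcstar pxk (lexx _).
set r := mxnorm (_ + k) => rxk.
apply: (ball_mxpositive mxnorm_mxcstar jxs (r := r)).
apply: le_trans rxk; rewrite opprD addrA; apply: boundary_mxnorm_le => a b.
  apply: jX; exists ((mxcscale (r%:C)%C 1%:M - x) a b) => //.
  by rewrite !mxE rmorphB /= linearZ /= rmorphMn rmorph1.
by rewrite mxE; apply: linear_subspaceN => //; have [] := Jk a b.
Qed.

Definition diag_system : set C := [set x | exists d, sa_part (x - j d)].

Lemma sa_part_linear : linear_subspace sa_part.
Proof.
have [_ linJ _ _] := XJ.1; have [J0 JL] := linJ.
split; first by rewrite /sa_part /= star0.
move=> c x y [Jx Jsx] [Jy Jsy]; split; first exact: JL.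
by rewrite starD starZ; exact: JL.
Qed.

Lemma diag_system_operator_system : operator_system diag_system.
Proof.
have linK := sa_part_linear; have [K0 KL] := linK.
split.
- by exists 1; rewrite rmorph1 subrr.
- split; first by exists 0; rewrite rmorph0 subrr.
  move=> c x y [d Kd] [e Ke]; exists (c *: d + e).
  by rewrite rmorphD /= linearZ opprD addrACA -scalerBr; exact: KL.
- move=> x [d [Jd Jsd]]; exists (star d); rewrite jP.1 -starB.
  by split; rewrite ?starK.
Qed.

Lemma diag_part_unique x d e : sa_part (x - j d) -> sa_part (x - j e) -> d = e.
Proof.
move=> [Jd _] [Je _]; have [_ linJ _ _] := XJ.1.
apply/subr0_eq/(inclusion_inj jP); rewrite rmorph0.
apply: boundary_ideal_disjoint; first by apply: jX; exists (d - e).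
rewrite rmorphB -(subrKA x); apply: linear_subspaceD => //.
by rewrite -opprB; exact: linear_subspaceN.
Qed.

(** The d is unique by [diag_part_unique]; 0 is the value outside [diag_system]. *)
Definition diag_part (x : C) : D := xget 0 [set d | sa_part (x - j d)].

Lemma diag_partP x : diag_system x -> sa_part (x - j (diag_part x)).
Proof. by move=> [d Kd]; rewrite /diag_part; case: xgetP => // /(_ d). Qed.

Lemma diag_partE x d : sa_part (x - j d) -> diag_part x = d.
Proof.
by move=> Kd; apply: (diag_part_unique _ Kd); apply: diag_partP; exists d.
Qed.

Lemma diag_part_ucp : ucp_on diag_system setT (iota \o diag_part).
Proof.
have [K0 KL] := sa_part_linear.
split; first split=> //=.
- by rewrite (@diag_partE 1 1) ?rmorph1 ?subrr.
- move=> c x y /diag_partP Kx /diag_partP Ky.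
  rewrite (@diag_partE _ (c *: diag_part x + diag_part y)).
    by rewrite rmorphD /= linearZ.
  by rewrite rmorphD /= linearZ opprD addrACA -scalerBr; exact: KL.
move=> n x Tx px; rewrite map_mx_comp; apply: (inclusion_mxpositive iotaP).
apply: (@boundary_mxpositive _ _ (x - map_mx j (map_mx diag_part x))).
  by move=> a b; rewrite !mxE; exact: diag_partP.
by rewrite addrC subrK.
Qed.

(** The extension of [diag_part] to C is a pseudo-expectation that vanishes on
    star x * x for x in J. *)
Lemma boundary_ideal_eq0 : injective_cstar E ->
  every_pseudo_expectation_faithful j iota -> J `<=` [set 0].
Proof.
move=> [_ injE] faithE x Jx /=.
have opT : operator_system [set: C] by [].
have [Phi [Phi_ucp PhiE]] :=
  injE C _ _ diag_system_operator_system opT (@subsetT _ _) _ diag_part_ucp.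
have [K0 _] := sa_part_linear.
have Phi_pe : pseudo_expectation j iota Phi.
  split=> // d; have Kd : sa_part (j d - j d) by rewrite subrr.
  by rewrite PhiE /= ?(diag_partE Kd) //; exists d.
apply: (faithE Phi Phi_pe).
have [JB _ _ Jideal] := XJ.1.
have Bs : generated_cstar X (star x).
  by move=> S SP; have [[_ _ Ss] _ _] := SP.1; exact: (Ss _ (JB _ Jx _ SP)).
have Kx : sa_part (star x * x - j 0).
  rewrite rmorph0 subr0 /sa_part /= starM starK.
  by have [] := Jideal _ _ Bs Jx.
by rewrite PhiE /= ?(diag_partE Kx) ?rmorph0 //; exists 0.
Qed.

End BoundaryIdeal.

Lemma boundary_ideal0 (R : realType) (C : cstarAlgType R) (X : set C) :
  boundary_ideal X [set 0].
Proof.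
split.
  split.
  - by move=> _ -> S [[[_ [S0 _] _] _ _] _].
  - by split=> // c x y -> ->; rewrite /= scaler0 addr0.
  - move=> x xP; apply: (@cnorm_eps_eq0 _ _ _ 1) => e /xP[y ->].
    by rewrite subr0 mul1r => /ltW.
  - by move=> b x _ ->; rewrite /= mulr0 mul0r.
move=> n x _; rewrite (_ : [set _ | _ in _] = [set mxnorm x]) ?inf1 //.
apply/seteqP; split=> [_ [k k0 <-]|_ ->] /=.
  by congr mxnorm; apply/matrixP => a b; rewrite mxE k0 addr0.
by exists 0; rewrite ?addr0 // => a b; rewrite mxE.
Qed.

Theorem theorem6p1 (R : realType) (C D E : cstarAlgType R)
    (j : {lrmorphism D -> C}) (hj : cstar_inclusion j)
    (iota : {lrmorphism D -> E}) (hiota : injective_envelope iota)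
    (hfaithful : every_pseudo_expectation_faithful j iota)
    (X : set C) (hX : linear_subspace X) (hDX : range j `<=` X) :
  cstar_envelope_eq_generated X.
Proof.
have [hi injE _] := hiota.
have J0 J : boundary_ideal X J -> J `<=` [set 0].
  by move=> XJ; exact: (boundary_ideal_eq0 hj hi hDX XJ injE hfaithful).
have b0 := boundary_ideal0 X.
move=> J; split=> [[XJ maxJ]|->]; last by split.
by apply/seteqP; split; [exact: J0|exact: maxJ].
Qed.
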